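(* For each $k \in \{6, 7, 8, 9\}$, consider the hypersurface arrangement $\mathcal{H}_k \subset \mathbb{P}^{14}_{\mathbb{C}}$ defined by $Q_k = f_1 f_2 f_3 f_4 f_5 f_k = 0$, and let $J_{Q_k} \subset S$ be the Jacobian ideal of $Q_k$. Then the Castelnuovo–Mumford regularity of the Milnor algebra $S/J_{Q_k}$ is $$\mathrm{reg}(S/J_{Q_k}) = 19$$ for each $k \in \{6, 7, 8, 9\}$, so an upper bound for the regularity, according to the content of Proposition 2.6 of L. Busé, A. Dimca, H. Schenck and G. Sticlaru (Adv. Math. 392 (2021), Article ID 108035), is reached.
   Context: Let $S = \mathbb{C}[x_1,\ldots,x_5,y_1,\ldots,y_5,z_1,\ldots,z_5]$ be the polynomial ring in 15 variables with its standard grading, the homogeneous coordinate ring of $\mathbb{P}^{14}_{\mathbb{C}}$. Consider the generic matrix $$M = \begin{pmatrix} x_1 & x_2 & x_3 & x_4 & x_5 \\ y_1 & y_2 & y_3 & y_4 & y_5 \\ z_1 & z_2 & z_3 & z_4 & z_5 \end{pmatrix}.$$ For $1 \leq a < b < c \leq 5$ let $\Delta_{abc} \in S$ denote the determinant of the $3\times 3$ submatrix of $M$ formed by columns $a,b,c$ (in this order). Set $f_1 = \Delta_{123}$, $f_2 = \Delta_{124}$, $f_3 = \Delta_{134}$, $f_4 = \Delta_{234}$, $f_5 = \Delta_{125}$, $f_6 = \Delta_{135}$, $f_7 = \Delta_{235}$, $f_8 = \Delta_{145}$, $f_9 = \Delta_{245}$, $f_{10} = \Delta_{345}$. For a homogeneous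 $F \in S$, the Jacobian ideal $J_F$ is the ideal of $S$ generated by the 15 first-order partial derivatives of $F$, and the Milnor algebra of $F$ is $S/J_F$. The regularity of a finitely generated graded $S$-module with minimal graded free resolution having $p$-th term $\bigoplus_q S(-q)^{\beta_{p,q}}$ is $\max\{q - p : \beta_{p,q} \neq 0\}$. *)

(* Defs.v *)
From HB Require Import structures.
From mathcomp Require Import all_boot all_order all_algebra.
From mathcomp Require Import generic_quotient ring_quotient.
From mathcomp Require Import complex mpoly.
From mathcomp Require Import boolp reals.

Set Implicit Arguments.
Unset Strict Implicit.
Unset Printing Implicit Defensive.

Import Order.TTheory GRing.Theory Num.Theory.
Local Open Scope ring_scope.
Local Open Scope quotient_scope.

Section GeneratedIdeal.
Variables (A : comNzRingType) (I : finType) (g : I -> A).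

Definition ideal_gen : {pred A} :=
  fun x => `[< exists c : I -> A, x = \sum_i c i * g i >].

Fact ideal_gen_zmod_closed : zmod_closed ideal_gen.
Proof.
split=> [|x y /asboolP[c ->] /asboolP[d ->]]; apply/asboolP.
  by exists (fun=> 0); rewrite big1 // => i _; rewrite mul0r.
exists (fun i => c i - d i); rewrite -sumrB.
by apply: eq_bigr => i _; rewrite mulrBl.
Qed.

HB.instance Definition _ :=
  GRing.isZmodClosed.Build A ideal_gen ideal_gen_zmod_closed.

Lemma ideal_genMl a x : x \in ideal_gen -> a * x \in ideal_gen.
Proof.
move=> /asboolP[c ->]; apply/asboolP; exists (fun i => a * c i).
by rewrite big_distrr; apply: eq_bigr => i _; rewrite /= mulrA.
Qed.

(* The A-module A / (g_i)_i.  The ring quotient [{ideal_quot _}] only gets its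
   structures for proper ideals and has no A-module structure, so the module
   structure is put on the quotient group here. *)
Definition quot_ideal := Quotient.quot ideal_gen.

HB.instance Definition _ := GRing.Zmodule.on quot_ideal.

Definition to_quot (x : A) : quot_ideal := \pi_(Quotient.quot ideal_gen) x.
Definition quot_scale (a : A) (q : quot_ideal) : quot_ideal :=
  to_quot (a * repr (q : Quotient.quot ideal_gen)).

Lemma to_quotP (x y : A) : to_quot x = to_quot y <-> x - y \in ideal_gen.
Proof. by rewrite Quotient.idealrBE /to_quot; split=> [-> |/eqP]. Qed.

Lemma to_quotD : {morph to_quot : x y / x + y}.
Proof. by move=> x y; rewrite /to_quot raddfD. Qed.

Lemma to_quot_surj q : exists x, q = to_quot x.
Proof. by exists (repr (q : Quotient.quot ideal_gen)); rewrite /to_quot reprK. Qed.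

Lemma quot_scaleE a x : quot_scale a (to_quot x) = to_quot (a * x).
Proof.
apply/to_quotP; rewrite -mulrBr; apply: ideal_genMl.
by apply/to_quotP; rewrite {1}/to_quot reprK.
Qed.

Fact quot_scaleA a b q : quot_scale a (quot_scale b q) = quot_scale (a * b) q.
Proof. by have [x ->] := to_quot_surj q; rewrite !quot_scaleE mulrA. Qed.

Fact quot_scale1 : left_id 1 quot_scale.
Proof. by move=> q; have [x ->] := to_quot_surj q; rewrite quot_scaleE mul1r. Qed.

Fact quot_scaleDr : right_distributive quot_scale +%R.
Proof.
move=> a p q; have [x ->] := to_quot_surj p; have [y ->] := to_quot_surj q.
by rewrite -to_quotD !quot_scaleE -to_quotD mulrDr.
Qed.

Fact quot_scaleDl q : {morph quot_scale^~ q : a b / a + b}.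
Proof.
move=> a b; have [x ->] := to_quot_surj q.
by rewrite !quot_scaleE -to_quotD mulrDl.
Qed.

HB.instance Definition _ := GRing.Zmodule_isLmodule.Build A quot_ideal
  quot_scaleA quot_scale1 quot_scaleDr quot_scaleDl.

End GeneratedIdeal.

Section Regularity.
Variables (K : fieldType) (n : nat).
Local Notation S := {mpoly K[n]}.

(* The graded piece S_d, for d : int; in particular it is 0 for d < 0. *)
Definition homog_deg (d : int) (p : S) : Prop :=
  forall m, m \in msupp p -> (mdeg m)%:Z = d.

(* Data of a complex ... -> F_2 -> F_1 -> F_0 -> M of free S-modules, where
   F_p = \bigoplus_(j < res_rank p) S(- res_shift p j).  Elements of F_p are row
   vectors, and the basis element j has degree [res_shift p j]; the map
   F_(p+1) -> F_p is v |-> v *m res_diff p, and F_0 -> M sends the basis element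
   j to [res_aug j]. *)
Record resolution_data (M : lmodType S) := ResolutionData {
  res_rank : nat -> nat;
  res_shift : forall p, 'I_(res_rank p) -> int;
  res_diff : forall p, 'M[S]_(res_rank p.+1, res_rank p);
  res_aug : 'I_(res_rank 0) -> M
}.

Definition res_aug_map (M : lmodType S) (F : resolution_data M)
  (v : 'rV[S]_(res_rank F 0)) : M := \sum_j v 0 j *: res_aug j.

(* [gr d] is the degree d piece of the graded module M.  The maps have degree
   0, the augmented complex is exact, and it is minimal: the image of F_(p+1)
   lies in (x_1, ..., x_n) F_p, i.e. no entry has a constant term. *)
Record minimal_graded_free_resolution (M : lmodType S) (gr : int -> M -> Prop)
    (F : resolution_data M) : Prop := {
  res_aug_graded : forall j, gr (res_shift j) (res_aug (r := F) j);
  res_diff_graded : forall p i j,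
    homog_deg (res_shift i - res_shift j) (res_diff F p i j);
  res_aug_surj : forall x, exists v, x = @res_aug_map M F v;
  res_exact0 : forall v,
    @res_aug_map M F v = 0 <-> exists w, v = w *m res_diff F 0;
  res_exact : forall p (v : 'rV[S]_(res_rank F p.+1)),
    v *m res_diff F p = 0 <-> exists w, v = w *m res_diff F p.+1;
  res_minimal : forall p i j, (res_diff F p i j)@_0%MM = 0
}.

Definition betti (M : lmodType S) (F : resolution_data M) (p : nat) (q : int)
  : nat := #|[set j : 'I_(res_rank F p) | res_shift j == q]|.

(* reg M = r.  The Betti numbers do not depend on the chosen minimal graded
   free resolution, so r is unique. *)
Definition has_regularity (M : lmodType S) (gr : int -> M -> Prop) (r : int)
  : Prop :=
  exists F : resolution_data M,
    [/\ minimal_graded_free_resolution gr F,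
        exists p q, betti F p q <> 0%N /\ q - p%:Z = r &
        forall p q, betti F p q <> 0%N -> q - p%:Z <= r].

(* S / J_F, where J_F is generated by the first-order partial derivatives. *)
Definition milnor_algebra (F : S) := quot_ideal (fun i : 'I_n => F^`M(i)).

HB.instance Definition _ F := GRing.Lmodule.on (milnor_algebra F).

Definition milnor_grading (F : S) (d : int) (x : milnor_algebra F) : Prop :=
  exists2 p : S, homog_deg d p & x = to_quot (fun i : 'I_n => F^`M(i)) p.

End Regularity.

Section GenericMatrix.
Variable R : realType.
Local Notation S := {mpoly R[i][15]}.

(* C is R[i], with R a model of the real numbers.  The variables of S are
   ordered as x_1, ..., x_5, y_1, ..., y_5, z_1, ..., z_5. *)
Definition generic_mx : 'M[S]_(3, 5) :=
  \matrix_(i < 3, j < 5) 'X_(inord (5 * i + j)).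

(* \Delta_abc; columns are numbered from 1. *)
Definition Delta (a b c : nat) : S :=
  \det (colsub (fun j : 'I_3 => inord (nth 0%N [:: a; b; c] j).-1) generic_mx).

(* f_k, for 1 <= k <= 10. *)
Definition fDelta (k : nat) : S :=
  nth 0 [:: Delta 1 2 3; Delta 1 2 4; Delta 1 3 4; Delta 2 3 4; Delta 1 2 5;
            Delta 1 3 5; Delta 2 3 5; Delta 1 4 5; Delta 2 4 5; Delta 3 4 5]
    k.-1.

Definition Qpoly (k : nat) : S :=
  fDelta 1 * fDelta 2 * fDelta 3 * fDelta 4 * fDelta 5 * fDelta k.

End GenericMatrix.

(* Main.v *)
(* Up to relabelling the columns v_1, ..., v_5, Q_k is, up to sign,
     Q = D_123 D_124 D_134 D_234 D_125 D_135,
   and it is a free divisor: the polynomial vector fields killing Q form a free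
   module of rank 14, so S / J_Q has the resolution
     0 -> S(-18)^13 (+) S(-21) -> S(-17)^15 -> S,
   whose last term gives the regularity 21 - 2 = 19.  A field killing Q moves
   v_j with velocity
     B v_j + l_j v_j (j <= 3),  B v_4,  B v_5 + n v_1 + m D_135 v_2 + l_5 v_5,
   where B is a 3 x 3 matrix and 2 l_5 is determined by the other parameters;
   only the field with parameter m has degree 4 instead of 1.

   To see that there are no others: the factors of Q are pairwise coprime, so a
   field killing Q multiplies each of them by some polynomial.  Subtracting a
   torus action we may assume that it kills the maximal minors of
   (v_1 v_2 v_3 v_4), and the Hilbert-Burch theorem provides B.  Then only v_5
   moves, and its velocity is found from D_125 and D_135.  All coprimality
   statements follow from coprimality of leading monomials, for suitable
   weights of the variables. *)

From HB Require Import structures.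
Require Import Defs.
From mathcomp Require Import all_boot all_order all_algebra complex mpoly reals.
From mathcomp Require Import boolp ring zify.

Set Implicit Arguments.
Unset Strict Implicit.
Unset Printing Implicit Defensive.

Import Order.TTheory GRing.Theory Num.Theory.
Local Open Scope ring_scope.

(** * Regular pairs and initial forms *)

Section Coprime.
Variable A : idomainType.
Implicit Types f g h k : A.

(* When f is not 0 this says that f, g is a (possibly improper) regular
   sequence; it replaces coprimality, without any factoriality. *)
Definition cop f g : Prop :=
  forall h k, f * k = g * h -> exists l, h = f * l.

Lemma cop_sym f g : f != 0 -> cop f g -> cop g f.
Proof.
move=> f0 fg h k e; have [l el] := fg k h (esym e).
by exists l; apply: (mulfI f0); rewrite -e el mulrCA.
Qed.

Lemma cop1 f : cop f 1.
Proof. by move=> h k; rewrite mul1r => <-; exists k. Qed.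

Lemma copMr f g1 g2 : cop f g1 -> cop f g2 -> cop f (g1 * g2).
Proof.
by move=> c1 c2 h k; rewrite -mulrA => /c1 [l /esym] /c2 [m ->]; exists m.
Qed.

Lemma cop_prod (I : eqType) f (s : seq I) (F : I -> A) :
  (forall i, i \in s -> cop f (F i)) -> cop f (\prod_(i <- s) F i).
Proof.
elim: s => [|i s IH] cs; first by rewrite big_nil; apply: cop1.
rewrite big_cons; apply: copMr; first by apply: cs; rewrite inE eqxx.
by apply: IH => x xs; apply: cs; rewrite inE xs orbT.
Qed.

Lemma copNr f g : cop f g -> cop f (- g).
Proof.
move=> c h k; rewrite mulNr -mulrN => /c [l e]; exists (- l).
by rewrite mulrN -e opprK.
Qed.

Lemma copNl f g : cop f g -> cop (- f) g.
Proof.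
move=> c h k; rewrite mulNr -mulrN => /c [l ->]; exists (- l).
by rewrite mulrNN.
Qed.

Variable E : {rmorphism A -> {poly A}}.
Local Notation initial f := (lead_coef (E f)).

(* E is the coaction of a grading of A: it multiplies the elements of weight d
   by 'X^d. *)
Hypothesis E_split : forall f, exists2 s : seq A, f = \sum_(x <- s) x
  & forall x, x \in s -> exists d, E x = x%:P * 'X^d.

(** Setting 'X to 1 forgets the weights; this makes [E] injective. *)
Let E_eval f : (E f).[1] = f.
Proof.
have [s -> hs] := E_split f; rewrite rmorph_sum horner_sum.
apply: eq_big_seq => x /hs [d ->].
by rewrite hornerM hornerXn hornerC expr1n mulr1.
Qed.

Let E_inj : injective E.
Proof. by move=> f g e; rewrite -[f]E_eval e E_eval. Qed.

(** The coefficient of 'X^j in [E f] is the sum of the summands of weight j, hence homogeneous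
    itself. *)
Let E_initial f : E (initial f) = (initial f)%:P * 'X^((size (E f)).-1).
Proof.
rewrite lead_coefE; move: _.-1 => j; have [s -> hs] := E_split f.
rewrite (rmorph_sum E) coef_sum !rmorph_sum mulr_suml.
apply: eq_big_seq => x /hs [d ed].
rewrite ed coefCM coefXn; have [->|_] := eqVneq j d; first by rewrite mulr1 ed.
by rewrite mulr0 rmorph0 mul0r.
Qed.

(* The division algorithm with respect to the filtration by the degree of E. *)
Lemma cop_initial f g : f != 0 -> cop (initial f) (initial g) -> cop f g.
Proof.
move=> f0 cfg h; move: {-1}(size _) (leqnn (size (E h))) => n.
elim: n h => [|n IH] h hn k e.
  exists 0; rewrite mulr0; apply: E_inj; rewrite rmorph0.
  by apply/eqP; rewrite -size_poly_eq0 -leqn0.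
have [->|h0] := eqVneq h 0; first by exists 0; rewrite mulr0.
have E0 x : (E x == 0) = (x == 0) by rewrite -(inj_eq E_inj) rmorph0.
have [l el] : exists l, initial h = initial f * l.
  by apply: (cfg _ (initial k)); rewrite -!lead_coefM -!rmorphM e.
have i0 : initial f != 0 by rewrite lead_coef_eq0 E0.
have l0 : l != 0.
  apply: contra_neq h0 => l0; apply/eqP; rewrite -E0 -lead_coef_eq0 el l0.
  by rewrite mulr0.
set wf := (size (E f)).-1; set wh := (size (E h)).-1.
have sE : forall x, x != 0 -> size (E x) = (size (E x)).-1.+1.
  by move=> x x0; rewrite prednK // size_poly_gt0 E0.
(* This says that [l] is homogeneous of weight [wh - wf], without a subtraction. *)
have El : 'X^wf * E l = l%:P * 'X^wh.
  apply: (@mulfI _ (initial f)%:P); first by rewrite polyC_eq0.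
  rewrite mulrA mulrA -polyCM -el -E_initial -rmorphM -E_initial.
  by rewrite el.
have Efl : E (f * l) * 'X^wf = l%:P * E f * 'X^wh.
  by rewrite rmorphM -mulrA [E l * _]mulrC El mulrCA mulrA.
have lc : initial (f * l) = initial h.
  have := congr1 lead_coef Efl.
  rewrite !lead_coefM !lead_coefXn lead_coefC !mulr1 el => ->.
  by rewrite mulrC.
have sz : size (E (f * l)) = size (E h).
  have := congr1 (fun p : {poly A} => size p) Efl.
  rewrite !size_mulXn ?mulf_neq0 ?E0 ?mulf_neq0 ?polyC_eq0 // size_Cmul //.
  rewrite (sE f) // (sE h) // -/wf -/wh => /eqP.
  by rewrite addnS -addSn addnC eqn_add2r => /eqP.
(* [f * l] has the same top coefficient as [h], so the remainder has lower degree under [E], and it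
   satisfies the same relation with [k - g * l]. *)
have [||m em] := IH (h - f * l) _ (k - g * l).
- rewrite -ltnS (leq_trans _ hn) // (sE h) // ltnS rmorphB.
  apply/leq_sizeP => j; rewrite leq_eqVlt coefB => /orP[/eqP<-|lj].
    by move: lc; rewrite /lead_coef sz => ->; rewrite subrr.
  rewrite !nth_default ?subrr // ?sz (sE h) //.
- by rewrite mulrBr e mulrBr mulrCA.
by exists (m + l); rewrite mulrDr -em subrK.
Qed.

End Coprime.

(** * Gradings of a polynomial ring by weights of the variables *)

Section Weight.
Variables (K : fieldType) (n : nat) (w : 'I_n -> nat).
Local Notation S := {mpoly K[n]}.

Definition weight_map : {rmorphism S -> {poly S}} :=
  mmap (polyC \o @mpolyC n K) (fun i => ('X_i)%:P * 'X^(w i)).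

Lemma weight_mapU i : weight_map 'X_i = ('X_i)%:P * 'X^(w i).
Proof. by rewrite /= mmapX mmap1U. Qed.

Lemma weight_mapC c : weight_map c%:MP = (c%:MP)%:P.
Proof. by rewrite /= mmapC. Qed.

Lemma weight_mapX m :
  exists d, weight_map 'X_[m] = ('X_[m])%:P * 'X^d.
Proof.
rewrite /= mmapX /mmap1; exists (\sum_i w i * m i)%N.
rewrite mpolyXE_id rmorph_prod -prodrXr -big_split /=.
by apply: eq_bigr => i _; rewrite exprMn -exprM rmorphXn.
Qed.

Lemma weight_mapZX c m :
  exists d, weight_map (c *: 'X_[m]) = (c *: 'X_[m])%:P * 'X^d.
Proof.
have [d ed] := weight_mapX m; exists d.
have <- : c%:MP * 'X_[m] = c *: 'X_[m] :> S := mul_mpolyC c 'X_[m].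
rewrite (rmorphM weight_map) weight_mapC ed mulrA.
by congr (_ * _); rewrite polyCM.
Qed.

(** Monomials split every polynomial into homogeneous parts, so [cop_initial] applies; [p] and [q]
    allow explicit initial forms to be supplied. *)
Lemma cop_weight (f g p q : S) : f != 0 ->
    lead_coef (weight_map f) = p -> lead_coef (weight_map g) = q ->
  cop p q -> cop f g.
Proof.
move=> f0 <- <-; apply: cop_initial f0 => h.
exists [seq h@_m *: 'X_[m] | m <- msupp h]; first by rewrite big_map -mpolyE.
by move=> _ /mapP[m _ ->]; apply: weight_mapZX.
Qed.

End Weight.

(** * Coprimality of monomials *)

Section Variables.
Variables (K : fieldType) (n : nat).
Local Notation S := {mpoly K[n]}.
Implicit Types i j : 'I_n.

Definition kill_var i : {rmorphism S -> S} :=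
  mmap (@mpolyC n K) (fun j => if j == i then 0 else 'X_j).

Lemma kill_varP i (p : S) : exists q, p = kill_var i p + 'X_i * q.
Proof.
elim/mpolyind: p => [|c m p _ _ [q eq]].
  by exists 0; rewrite rmorph0 mulr0 addr0.
rewrite rmorphD -mul_mpolyC rmorphM /= mmapC mmapX.
have [m0|mi] := eqVneq (m i) 0%N.
  exists q; rewrite -addrA -eq /mmap1 [in LHS]mpolyXE_id; congr (_ * _ + _).
  apply: eq_bigr => j _; case: eqP => [->|//].
  by rewrite m0 !expr0.
exists (c%:MP * 'X_[(m - U_(i))] + q).
rewrite /mmap1 (bigD1 i) //= eqxx expr0n (negPf mi) mul0r mulr0 add0r.
rewrite mulrDr addrCA -eq mulrCA -mpolyXD addmC submK //.
by apply/mnm_lepP => j; rewrite mnm1E; case: eqP => // <-; rewrite lt0n.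
Qed.

Lemma mpolyX_neq0 i : ('X_i : S) != 0.
Proof. by rewrite -msize_poly_eq0 msizeX mdeg1. Qed.

Lemma cop_var i j : i != j -> cop ('X_i : S) 'X_j.
Proof.
move=> ij h k e; have [l el] := kill_varP i h; exists l.
(* Modulo 'X_i the relation says that 'X_j times the reduction of [h] is 0. *)
rewrite {1}el; suff -> : kill_var i h = 0 by rewrite add0r.
move/(congr1 (kill_var i)): e.
rewrite !rmorphM /= !mmapX !mmap1U eqxx eq_sym (negPf ij) mul0r => /esym/eqP.
by rewrite mulf_eq0 (negPf (mpolyX_neq0 j)) => /eqP.
Qed.

Lemma cop_vars (s t : seq 'I_n) : ~~ has (mem s) t ->
  cop (\prod_(i <- s) 'X_i : S) (\prod_(j <- t) 'X_j).
Proof.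
have nz i : ('X_i : S) != 0 by exact: mpolyX_neq0.
move=> /hasPn st; apply: cop_prod => j jt; apply: cop_sym => //.
apply: cop_prod => i si; apply: cop_var.
by apply: contraNneq (st j jt) => ->.
Qed.

End Variables.

(** * Vector fields on five vectors of a 3-space *)

Definition r0 : 'I_3 := ord0.
Definition r1 : 'I_3 := @Ordinal 3 1 isT.
Definition r2 : 'I_3 := @Ordinal 3 2 isT.

Lemma forall3 (P : 'I_3 -> Prop) : P r0 -> P r1 -> P r2 -> forall i, P i.
Proof.
move=> P0 P1 P2 [[|[|[|i]]] hi] //.
- by rewrite (_ : Ordinal hi = r0) //; apply: val_inj.
- by rewrite (_ : Ordinal hi = r1) //; apply: val_inj.
- by rewrite (_ : Ordinal hi = r2) //; apply: val_inj.
Qed.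

Definition vec3 T (a b c : T) : 'I_3 -> T :=
  fun i => match val i with 0%N => a | 1%N => b | _ => c end.

Lemma vec3E T (a b c : T) :
  (vec3 a b c r0 = a) * (vec3 a b c r1 = b) * (vec3 a b c r2 = c).
Proof. by []. Qed.

Lemma exists3 T (P : 'I_3 -> T -> Prop) :
  (forall i, exists x, P i x) -> exists f, forall i, P i (f i).
Proof.
move=> h; have [a Pa] := h r0; have [b Pb] := h r1; have [c Pc] := h r2.
by exists (vec3 a b c); apply: forall3.
Qed.

Section ThreeDim.
Variable A : idomainType.
Implicit Types (x y z u v : 'I_3 -> A) (B : 'I_3 -> 'I_3 -> A).

Definition dot x y : A := x r0 * y r0 + x r1 * y r1 + x r2 * y r2.

Definition minor x y i j : A := x i * y j - x j * y i.

Definition cross x y : 'I_3 -> A :=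
  vec3 (minor x y r1 r2) (minor x y r2 r0) (minor x y r0 r1).

Definition dt x y z : A := dot x (cross y z).

(** Leibniz rule: the derivative of the determinant [dt x y z] when its columns move with velocities
    [x'], [y'], [z']. *)
Definition ddt x y z x' y' z' : A := dt x' y z + dt x y' z + dt x y z'.

Definition tr3 B : A := B r0 r0 + B r1 r1 + B r2 r2.

Local Ltac vring := rewrite /ddt /dt /dot /tr3 /cross ?vec3E /minor; ring.

Lemma ddt_linear x y z B : ddt x y z (fun i => dot (B i) x)
  (fun i => dot (B i) y) (fun i => dot (B i) z) = tr3 B * dt x y z.
Proof. vring. Qed.

Lemma ddt_scale x y z a b c x' y' z' :
  ddt x y z (fun i => x' i + a * x i) (fun i => y' i + b * y i)
    (fun i => z' i + c * z i) = ddt x y z x' y' z' + (a + b + c) * dt x y z.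
Proof. vring. Qed.

Lemma ddt_affine x y z B a b c w : ddt x y z (fun i => dot (B i) x + a * x i)
    (fun i => dot (B i) y + b * y i) (fun i => dot (B i) z + w i + c * z i)
  = (tr3 B + (a + b + c)) * dt x y z + dt x y w.
Proof. vring. Qed.

Lemma eq_ddt x y z x' y' z' x'' y'' z'' : x' =1 x'' -> y' =1 y'' -> z' =1 z'' ->
  ddt x y z x' y' z' = ddt x y z x'' y'' z''.
Proof.
by move=> ex ey ez; rewrite /ddt /dt /dot /cross /minor /= !ex !ey !ez.
Qed.

(* Exactness of the Hilbert-Burch complex of the 3 x 4 matrix (v1 v2 v3 v4). *)
Lemma orthogonal_minors34 v1 v2 v3 v4 a1 a2 a3 a4 :
    dt v1 v2 v3 != 0 -> cop (dt v1 v2 v3) (dt v1 v2 v4) ->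
    dt v1 v2 v3 * a4 = a1 * dt v4 v2 v3 + a2 * dt v1 v4 v3 + a3 * dt v1 v2 v4 ->
  exists b, [/\ a1 = dot b v1, a2 = dot b v2, a3 = dot b v3 & a4 = dot b v4].
Proof.
move=> f0 cfg rel.
(* Cramer's rule on v1, v2, v3 gives b as [n] over [dt v1 v2 v3], and on v1, v2, v4 as [n'] over
   [dt v1 v2 v4]. The fractions agree by [rel], and coprimality removes the denominator. *)
pose n i := a1 * cross v2 v3 i + a2 * cross v3 v1 i + a3 * cross v1 v2 i.
pose n' i := a1 * cross v2 v4 i + a2 * cross v4 v1 i + a4 * cross v1 v2 i.
have nn' i : dt v1 v2 v3 * n' i = dt v1 v2 v4 * n i.
  apply: subr0_eq.
  have -> : dt v1 v2 v3 * n' i - dt v1 v2 v4 * n i = cross v1 v2 i *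
      (dt v1 v2 v3 * a4 -
       (a1 * dt v4 v2 v3 + a2 * dt v1 v4 v3 + a3 * dt v1 v2 v4)).
    by rewrite /n /n'; move: i; apply: forall3; vring.
  by rewrite rel subrr mulr0.
have [b bP] := exists3 (P := fun i c => n i = dt v1 v2 v3 * c)
  (fun i => cfg _ _ (nn' i)).
have nb v a : dt v1 v2 v3 * a = dot n v -> a = dot b v.
  by move=> e; apply: (mulfI f0); rewrite e /dot !bP; ring.
by exists b; split; apply: nb; rewrite ?rel /n; vring.
Qed.

(** Cramer's rule on the coordinates r0, r1 gives the coefficients as fractions; the coordinates r0,
    r2 give the same fractions over a coprime denominator. *)
Lemma span_of_dt0 x y u : minor x y r0 r1 != 0 ->
    cop (minor x y r0 r1) (minor x y r0 r2) -> dt x y u = 0 ->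
  exists a b, forall i, u i = a * x i + b * y i.
Proof.
move=> m0 cm du0.
have [|a ea] := cm (minor u y r0 r1) (minor u y r0 r2).
  apply: subr0_eq; rewrite [LHS](_ : _ = - y r0 * dt x y u); last by vring.
  by rewrite du0 mulr0.
have [|b eb] := cm (minor x u r0 r1) (minor x u r0 r2).
  apply: subr0_eq; rewrite [LHS](_ : _ = x r0 * dt x y u); last by vring.
  by rewrite du0 mulr0.
exists a, b => i; apply: (mulfI m0); rewrite mulrDr !mulrA -ea -eb.
apply: subr0_eq.
move: i; apply: forall3; last first.
- by rewrite -[RHS]du0; vring.
- by vring.
- by vring.
Qed.

End ThreeDim.

(** * Vector fields preserving the six determinants *)

Section FiveVectors.
Variable A : idomainType.
Implicit Types (x y z u v : 'I_3 -> A) (B : 'I_3 -> 'I_3 -> A).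

Local Ltac vring := rewrite /ddt /dt /dot /tr3 /cross ?vec3E /minor; ring.

Lemma dt_indep x y z (a b c : A) : dt x y z != 0 ->
    (forall i, a * x i + b * y i + c * z i = 0) -> [/\ a = 0, b = 0 & c = 0].
Proof.
move=> f0 e; pose s i := a * x i + b * y i + c * z i.
have s0 i : s i = 0 := e i.
by split; apply: (mulIf f0); rewrite mul0r;
  [transitivity (dt s y z) | transitivity (dt x s z) | transitivity (dt x y s)];
  try (by rewrite /s; vring);
  rewrite /dt /dot /cross ?vec3E /minor !s0; ring.
Qed.

Lemma dot_eq0 x y z (b : 'I_3 -> A) : dt x y z != 0 ->
  dot b x = 0 -> dot b y = 0 -> dot b z = 0 -> forall i, b i = 0.
Proof.
move=> f0 ex ey ez i; apply: (mulfI f0).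
transitivity (dot b x * cross y z i + dot b y * cross z x i
              + dot b z * cross x y i); last by rewrite ex ey ez; ring.
by move: i; apply: forall3; vring.
Qed.

Variables v1 v2 v3 v4 v5 : 'I_3 -> A.
Local Notation f123 := (dt v1 v2 v3).
Local Notation f124 := (dt v1 v2 v4).
Local Notation f134 := (dt v1 v3 v4).
Local Notation f234 := (dt v2 v3 v4).
Local Notation f125 := (dt v1 v2 v5).
Local Notation f135 := (dt v1 v3 v5).

(** Giving v4 no scaling of its own uses up the freedom to add a scalar matrix to [fpB], which makes
    the parameters unique. *)
Record field_param := FieldParam {
  fpB : 'I_3 -> 'I_3 -> A; fp1 : A; fp2 : A; fp3 : A; fpn : A; fpm : A }.

(** [l5] stays outside the parameters, because it is fixed only by the requirement that the product
    of the determinants be killed. *)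
Record is_field (p : field_param) (l5 : A) u1 u2 u3 u4 u5 : Prop := IsField {
  field1 : forall i, u1 i = dot (fpB p i) v1 + fp1 p * v1 i;
  field2 : forall i, u2 i = dot (fpB p i) v2 + fp2 p * v2 i;
  field3 : forall i, u3 i = dot (fpB p i) v3 + fp3 p * v3 i;
  field4 : forall i, u4 i = dot (fpB p i) v4;
  field5 : forall i, u5 i =
    dot (fpB p i) v5 + fpn p * v1 i + fpm p * f135 * v2 i + l5 * v5 i }.

Hypothesis f123_neq0 : f123 != 0.

Lemma field_eq0 p l5 u1 u2 u3 u4 u5 :
    f124 != 0 -> f134 != 0 -> f234 != 0 -> f125 != 0 -> f135 != 0 ->
    is_field p l5 u1 u2 u3 u4 u5 ->
    (forall i, [/\ u1 i = 0, u2 i = 0, u3 i = 0, u4 i = 0 & u5 i = 0]) ->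
  (forall i j, fpB p i j = 0) /\
  [/\ fp1 p = 0, fp2 p = 0, fp3 p = 0, fpn p = 0 & fpm p = 0].
Proof.
case: p => B l1 l2 l3 n m n124 n134 n234 n125 n135 [/=e1 e2 e3 e4 e5] u0.
have B1 i : dot (B i) v1 = - (l1 * v1 i).
  by apply/eqP; rewrite -addr_eq0 -e1; case: (u0 i) => -> _ _ _ _.
have B2 i : dot (B i) v2 = - (l2 * v2 i).
  by apply/eqP; rewrite -addr_eq0 -e2; case: (u0 i) => _ -> _ _ _.
have B3 i : dot (B i) v3 = - (l3 * v3 i).
  by apply/eqP; rewrite -addr_eq0 -e3; case: (u0 i) => _ _ -> _ _.
have B4 i : dot (B i) v4 = 0 by rewrite -e4; case: (u0 i).
have [] := @dt_indep v1 v2 v3 (f234 * l1) (- f134 * l2) (f124 * l3) f123_neq0.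
  move=> i; transitivity (- (f123 * dot (B i) v4)); last by rewrite B4; ring.
  (* Cramer's identity f123 v4 = f234 v1 - f134 v2 + f124 v3, paired with [B i]. *)
  have -> : f123 * dot (B i) v4 = f234 * dot (B i) v1 - f134 * dot (B i) v2
     + f124 * dot (B i) v3 by vring.
  by rewrite B1 B2 B3; ring.
move=> /eqP; rewrite mulf_eq0 (negPf n234) => /eqP l10.
move=> /eqP; rewrite mulf_eq0 oppr_eq0 (negPf n134) => /eqP l20.
move=> /eqP; rewrite mulf_eq0 (negPf n124) => /eqP l30.
have B0 i j : B i j = 0.
  move: j; apply: (dot_eq0 f123_neq0).
  - by rewrite B1 l10 mul0r oppr0.
  - by rewrite B2 l20 mul0r oppr0.
  - by rewrite B3 l30 mul0r oppr0.
split=> //; have [|n0 /eqP m0 _] := @dt_indep v1 v2 v5 n (m * f135) l5 n125.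
  move=> i; have [_ _ _ _ <-] := u0 i; rewrite e5 /dot !B0; ring.
by move: m0; rewrite mulf_eq0 (negPf n135) orbF => /eqP m0; split.
Qed.

Section Derivation.
Variable D : A -> A.
Hypothesis DD : {morph D : a b / a + b}.
Hypothesis DM : forall a b, D (a * b) = D a * b + a * D b.

Lemma D_opp a : D (- a) = - D a.
Proof.
have D0 : D 0 = 0 by apply: (addrI (D 0)); rewrite -DD !addr0.
by apply/eqP; rewrite -addr_eq0 -DD addNr D0.
Qed.

Lemma D_dt x y z : D (dt x y z) = ddt x y z (D \o x) (D \o y) (D \o z).
Proof.
rewrite /ddt /dt /dot /cross ?vec3E /minor /= !(DD, D_opp, DM).
by ring.
Qed.

Lemma D_log_mul (f g a b : A) :
  D f = a * f -> D g = b * g -> D (f * g) = (a + b) * (f * g).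
Proof. by move=> ef eg; rewrite DM ef eg; ring. Qed.

(** From [f * (c * g - D g) = g * D f], coprimality makes [f] divide [D f]; symmetrically for
    [g]. *)
Lemma D_log_factors (f g : A) : f != 0 -> cop f g ->
    (exists c, D (f * g) = c * (f * g)) ->
  (exists c, D f = c * f) /\ (exists c, D g = c * g).
Proof.
move=> f0 cfg [c]; rewrite DM => e; split.
  have [|a ea] := cfg (D f) (c * g - D g); last by exists a; rewrite ea mulrC.
  by rewrite mulrBr mulrCA -e; ring.
have [|a ea] := cop_sym f0 cfg (h := D g) (k := c * f - D f).
  by rewrite mulrBr [g * (c * f)]mulrC -mulrA -e; ring.
by exists a; rewrite ea mulrC.
Qed.

(** Bracketed to the right so that [D_log_factors] can split off one factor at a time. *)
Definition sixfold : A := f123 * (f124 * (f134 * (f234 * (f125 * f135)))).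

Let D_field p l5 :=
  is_field p l5 (D \o v1) (D \o v2) (D \o v3) (D \o v4) (D \o v5).

(** The coefficients 5, 4, 4, 2 count the factors containing v1, v2, v3, v5. The last term comes
    from [f135] alone: the displacement of v5 along v2 contributes a multiple of dt v1 v3 v2 = -
    f123, and leaves [f125] unchanged. *)
Lemma D_sixfold p l5 : D_field p l5 ->
  D sixfold = (6 * tr3 (fpB p) + 5 * fp1 p + 4 * fp2 p + 4 * fp3 p + 2 * l5
               - fpm p * f123) * sixfold.
Proof.
case: p => B m1 m2 m3 n m [/= e1 e2 e3 e4 e5].
have e4' i : D (v4 i) = dot (B i) v4 + 0 * v4 i by rewrite e4 mul0r addr0.
pose w i := n * v1 i + m * f135 * v2 i.
have e5' i : D (v5 i) = dot (B i) v5 + w i + l5 * v5 i by rewrite e5 /w addrA.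
have h x y z a b c :
    (forall i, D (x i) = dot (B i) x + a * x i) ->
    (forall i, D (y i) = dot (B i) y + b * y i) ->
    (forall i, D (z i) = dot (B i) z + c * z i) ->
    D (dt x y z) = (tr3 B + (a + b + c)) * dt x y z.
  move=> hx hy hz; rewrite D_dt (eq_ddt _ _ _ hx hy hz).
  by rewrite ddt_scale ddt_linear -mulrDl.
have d123 := h _ _ _ _ _ _ e1 e2 e3; have d124 := h _ _ _ _ _ _ e1 e2 e4'.
have d134 := h _ _ _ _ _ _ e1 e3 e4'; have d234 := h _ _ _ _ _ _ e2 e3 e4'.
have d125 : D f125 = (tr3 B + (m1 + m2 + l5)) * f125.
  rewrite D_dt (eq_ddt _ _ _ e1 e2 e5') ddt_affine -[RHS]addr0.
  by congr (_ + _); rewrite /w; move: f135 => g; vring.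
have d135 : D f135 = (tr3 B + (m1 + m3 + l5) - m * f123) * f135.
  rewrite D_dt (eq_ddt _ _ _ e1 e3 e5') ddt_affine [RHS]mulrBl.
  by congr (_ + _); rewrite /w; move: f135 => g; vring.
rewrite /sixfold (D_log_mul d123 (D_log_mul d124 (D_log_mul d134 (D_log_mul d234
  (D_log_mul d125 d135))))).
by congr (_ * _); ring.
Qed.

Hypothesis unit3 : (3%:R : A) \is a GRing.unit.
Hypothesis cop_123_124 : cop f123 f124.
Hypothesis cop_135_123 : cop f135 f123.
Hypothesis minor_neq0 : minor v1 v2 r0 r1 != 0.
Hypothesis cop_minor : cop (minor v1 v2 r0 r1) (minor v1 v2 r0 r2).

Lemma logarithmic_field4 :
    (exists c, D f123 = c * f123) -> (exists c, D f124 = c * f124) ->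
    (exists c, D f134 = c * f134) -> (exists c, D f234 = c * f234) ->
  exists B (l1 l2 l3 : A),
    [/\ forall i, D (v1 i) = dot (B i) v1 + l1 * v1 i,
        forall i, D (v2 i) = dot (B i) v2 + l2 * v2 i,
        forall i, D (v3 i) = dot (B i) v3 + l3 * v3 i &
        forall i, D (v4 i) = dot (B i) v4].
Proof.
move=> [c4 h4] [c3 h3] [c2 h2] [c1 h1].
(* Here c_j belongs to the minor omitting v_j, and scalings t_j are sought whose sum without t_j is
   c_j. Adding the four equations shows that the sum of all t_j is [s], hence t_j = s - c_j. *)
pose s := (c1 + c2 + c3 + c4) / 3.
have s3 : 3 * s = c1 + c2 + c3 + c4 by rewrite mulrC divrK.
pose t1 := s - c1; pose t2 := s - c2; pose t3 := s - c3; pose t4 := s - c4.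
(* After subtracting a torus field, the derivation kills the four minors of
   (v1 v2 v3 v4). *)
have [w1 [w2 [w3 [w4 [e1 e2 e3 e4]]]]] : exists w1 w2 w3 w4 : 'I_3 -> A,
    [/\ forall i, D (v1 i) = w1 i + t1 * v1 i,
        forall i, D (v2 i) = w2 i + t2 * v2 i,
        forall i, D (v3 i) = w3 i + t3 * v3 i &
        forall i, D (v4 i) = w4 i + t4 * v4 i].
  exists (fun i => D (v1 i) - t1 * v1 i), (fun i => D (v2 i) - t2 * v2 i),
    (fun i => D (v3 i) - t3 * v3 i), (fun i => D (v4 i) - t4 * v4 i).
  by split=> i; rewrite subrK.
have h x y z p q r c (x' y' z' : 'I_3 -> A) :
    (forall i, D (x i) = x' i + p * x i) ->
    (forall i, D (y i) = y' i + q * y i) ->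
    (forall i, D (z i) = z' i + r * z i) ->
    D (dt x y z) = c * dt x y z ->
  ddt x y z x' y' z' = (c - (p + q + r)) * dt x y z.
  move=> hx hy hz; rewrite D_dt (eq_ddt _ _ _ hx hy hz) ddt_scale mulrBl => <-.
  by rewrite addrK.
have k4 := h _ _ _ _ _ _ _ _ _ _ e1 e2 e3 h4.
have k3 := h _ _ _ _ _ _ _ _ _ _ e1 e2 e4 h3.
have k2 := h _ _ _ _ _ _ _ _ _ _ e1 e3 e4 h2.
have k1 := h _ _ _ _ _ _ _ _ _ _ e2 e3 e4 h1.
rewrite (_ : c4 - _ = c1 + c2 + c3 + c4 - 3 * s) in k4;
  last by rewrite /t1 /t2 /t3; ring.
rewrite (_ : c3 - _ = c1 + c2 + c3 + c4 - 3 * s) in k3;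
  last by rewrite /t1 /t2 /t4; ring.
rewrite (_ : c2 - _ = c1 + c2 + c3 + c4 - 3 * s) in k2;
  last by rewrite /t1 /t3 /t4; ring.
rewrite (_ : c1 - _ = c1 + c2 + c3 + c4 - 3 * s) in k1;
  last by rewrite /t2 /t3 /t4; ring.
rewrite s3 subrr mul0r in k1 k2 k3 k4.
have [B bP] : exists B : 'I_3 -> 'I_3 -> A, forall i,
    [/\ w1 i = dot (B i) v1, w2 i = dot (B i) v2, w3 i = dot (B i) v3
      & w4 i = dot (B i) v4].
  apply: (exists3 (P := fun i b => [/\ w1 i = dot b v1, w2 i = dot b v2,
    w3 i = dot b v3 & w4 i = dot b v4])) => i.
  apply: orthogonal_minors34 => //; apply: subr0_eq.
  (* The identity f234 v1 - f134 v2 + f124 v3 - f123 v4 = 0, differentiated along w1, ..., w4; the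
     derivatives of the minors vanish. *)
  transitivity (ddt v2 v3 v4 w2 w3 w4 * v1 i - ddt v1 v3 v4 w1 w3 w4 * v2 i
    + ddt v1 v2 v4 w1 w2 w4 * v3 i - ddt v1 v2 v3 w1 w2 w3 * v4 i); last first.
    by rewrite k1 k2 k3 k4; ring.
  by move: i; apply: forall3; vring.
(* The scaling [t4] of v4 is moved into the matrix. *)
pose B' i j := B i j + (if i == j then t4 else 0).
have BE x i : dot (B' i) x = dot (B i) x + t4 * x i.
  by move: i; apply: forall3; rewrite /dot /B' /=; ring.
exists B', (t1 - t4), (t2 - t4), (t3 - t4); split=> i.
- by rewrite e1 BE; have [-> _ _ _] := bP i; ring.
- by rewrite e2 BE; have [_ -> _ _] := bP i; ring.
- by rewrite e3 BE; have [_ _ -> _] := bP i; ring.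
- by rewrite e4 BE; have [_ _ _ ->] := bP i; ring.
Qed.

Lemma logarithmic_field :
    (exists c, D f123 = c * f123) -> (exists c, D f124 = c * f124) ->
    (exists c, D f134 = c * f134) -> (exists c, D f234 = c * f234) ->
    (exists c, D f125 = c * f125) -> (exists c, D f135 = c * f135) ->
  exists p l5, D_field p l5.
Proof.
move=> h123 h124 h134 h234 [a h125] [b h135].
have [B [l1 [l2 [l3 [e1 e2 e3 e4]]]]] := logarithmic_field4 h123 h124 h134 h234.
pose w i := D (v5 i) - dot (B i) v5.
(* [l5] and [l5'] are the scalings of v5 that [f125] and [f135] ask for. The first is chosen; a
   displacement along v2 has to account for the difference. *)
pose l5 := a - tr3 B - l1 - l2; pose l5' := b - tr3 B - l1 - l3.
pose w' i := w i - l5 * v5 i.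
have e5 i : D (v5 i) = dot (B i) v5 + w' i + l5 * v5 i by rewrite /w' /w; ring.
have w125 : dt v1 v2 w' = 0.
  transitivity (D f125 - (tr3 B + (l1 + l2 + l5)) * f125).
    by rewrite D_dt (eq_ddt _ _ _ e1 e2 e5) ddt_affine; ring.
  by rewrite h125 /l5; ring.
have w135 : dt v1 v3 w' = (l5' - l5) * f135.
  transitivity (D f135 - (tr3 B + (l1 + l3 + l5)) * f135).
    by rewrite D_dt (eq_ddt _ _ _ e1 e3 e5) ddt_affine; ring.
  by rewrite h135 /l5'; ring.
have [n [k ek]] := span_of_dt0 minor_neq0 cop_minor w125.
(* As w' = n v1 + k v2, [w135] reads [k * f123 = (l5 - l5') * f135], so [f135] divides [k]. *)
have [|m em] := cop_135_123 (h := k) (k := l5 - l5').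
  rewrite mulrC; apply: oppr_inj; rewrite -mulNr opprB -w135.
  by rewrite /dt /dot /cross ?vec3E /minor !ek; ring.
exists (FieldParam B l1 l2 l3 n m), l5; split=> //= i.
by rewrite e5 ek em; ring.
Qed.

End Derivation.
End FiveVectors.

(** * Maximal minors of the generic matrix *)

Section InitialForms.
Variables (A : idomainType) (E : {rmorphism A -> {poly A}}).
Implicit Types (x y z : 'I_3 -> A) (e f g : 'I_3 -> nat).

Local Notation graded x e := (forall i, E (x i) = (x i)%:P * 'X^(e i)).

Lemma size_polyD_leq (p q : {poly A}) n :
  (size p <= n -> size q <= n -> size (p + q)%R <= n)%N.
Proof. by move=> hp hq; rewrite (leq_trans (size_polyD p q)) // geq_max hp. Qed.

Lemma size_polyCXn_leq (a : A) d n : (d < n)%N -> (size (a%:P * 'X^d)%R <= n)%N.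
Proof.
move=> dn; have [->|a0] := eqVneq a 0; first by rewrite mul0r size_poly0.
by rewrite size_mulXn ?polyC_eq0 // size_polyC a0 addn1.
Qed.

Lemma lead_coef_add_lower (a : A) d (p : {poly A}) :
  a != 0 -> (size p <= d)%N -> lead_coef (a%:P * 'X^d + p) = a.
Proof.
move=> a0 sp; rewrite lead_coefDl.
  by rewrite lead_coefM lead_coefC lead_coefXn mulr1.
by rewrite size_mulXn ?polyC_eq0 // size_polyC a0 addn1 ltnS.
Qed.

Lemma initial_minor x y e f i j : graded x e -> graded y f ->
    x i * y j != 0 -> (e j + f i < e i + f j)%N ->
  lead_coef (E (minor x y i j)) = x i * y j.
Proof.
move=> hx hy n0 lt; rewrite -[RHS](@lead_coef_add_lower _ (e i + f j)%N
   (- (x j * y i)%:P * 'X^(e j + f i))) //; last first.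
  by rewrite -polyCN; apply: size_polyCXn_leq.
congr lead_coef; rewrite /minor !(rmorphD, rmorphN, rmorphM) !hx !hy !exprD.
by ring.
Qed.

(** The five inequalities make the diagonal term of the determinant strictly heavier than each of
    the other five terms. *)
Lemma initial_dt x y z e f g : graded x e -> graded y f -> graded z g ->
    x r0 * (y r1 * z r2) != 0 ->
    (let d := e r0 + (f r1 + g r2) in
     [&& e r0 + f r2 + g r1 < d, e r1 + f r0 + g r2 < d, e r1 + f r2 + g r0 < d,
         e r2 + f r0 + g r1 < d & e r2 + f r1 + g r0 < d])%N ->
  lead_coef (E (dt x y z)) = x r0 * (y r1 * z r2).
Proof.
move=> hx hy hz n0 /and5P[l1 l2 l3 l4 l5].
pose T i j k : {poly A} := (x i * y j * z k)%:P * 'X^(e i + f j + g k).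
have sT i j k d : (e i + f j + g k < d -> size (T i j k) <= d)%N.
  exact: size_polyCXn_leq.
have sTN i j k d : (e i + f j + g k < d -> size (- T i j k)%R <= d)%N.
  by rewrite size_polyN; apply: sT.
rewrite -[RHS](@lead_coef_add_lower _ (e r0 + (f r1 + g r2))%N
  (- T r0 r2 r1 + (- T r1 r0 r2 + (T r1 r2 r0
   + (T r2 r0 r1 + - T r2 r1 r0))))) //; last first.
  by do ![apply: size_polyD_leq | apply: sTN => // | apply: sT => //].
congr lead_coef; rewrite /T /dt /dot /cross !vec3E /minor.
rewrite !(rmorphD, rmorphN, rmorphM) !hx !hy !hz !exprD.
by ring.
Qed.

End InitialForms.

Section Columns.
Variable K : fieldType.
Local Notation S := {mpoly K[15]}.

Definition idx (i : 'I_3) (j : 'I_5) : 'I_15 := inord (5 * i + j).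

Lemma idx_eq i j i' j' : (idx i j == idx i' j') = (i == i') && (j == j').
Proof.
have := (ltn_ord i, ltn_ord j, ltn_ord i', ltn_ord j').
move=> [[[hi hj] hi'] hj']; rewrite -![_ == _ :> 'I__]val_eqE /= !inordK; lia.
Qed.

Definition column (j : 'I_5) (i : 'I_3) : S := 'X_(idx i j).

(** A term of a 3 x 3 minor has weight 3 if [W] contains all its variables and less otherwise, so
    [W] can single out one term. *)
Definition indicator_weight (W : seq 'I_15) (n : 'I_15) : nat := n \in W.

Lemma column_graded W j i : weight_map K (indicator_weight W) (column j i) =
  (column j i)%:P * 'X^(indicator_weight W (idx i j)).
Proof. exact: weight_mapU. Qed.

Lemma initial_column_dt W a b c :
    (let e i j := indicator_weight W (idx i j) in
     let d := e r0 a + (e r1 b + e r2 c) in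
     [&& e r0 a + e r2 b + e r1 c < d, e r1 a + e r0 b + e r2 c < d,
         e r1 a + e r2 b + e r0 c < d, e r2 a + e r0 b + e r1 c < d
       & e r2 a + e r1 b + e r0 c < d])%N ->
  lead_coef
    (weight_map K (indicator_weight W) (dt (column a) (column b) (column c)))
  = \prod_(n <- [:: idx r0 a; idx r1 b; idx r2 c]) 'X_n.
Proof.
move=> h; rewrite !big_cons big_nil mulr1.
apply: initial_dt h; try exact: column_graded.
by rewrite !mulf_neq0 // mpolyX_neq0.
Qed.

Lemma eq_false2 (T : eqType) (i j : T) :
  i != j -> ((i == j) = false) * ((j == i) = false).
Proof. by move=> ij; rewrite [j == i]eq_sym (negPf ij). Qed.

Lemma initial_neq0 (w : 'I_15 -> nat) (f : S) (s : seq 'I_15) :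
  lead_coef (weight_map K w f) = \prod_(n <- s) 'X_n -> f != 0.
Proof.
move=> h; apply/eqP => f0; move: h.
rewrite f0 (rmorph0 (weight_map K w)) lead_coef0 => /esym/eqP; apply/negP.
elim: s => [|n s IH]; first by rewrite big_nil oner_neq0.
by rewrite big_cons mulf_neq0 ?mpolyX_neq0.
Qed.

Lemma cop_initial_vars (w : 'I_15 -> nat) (f g : S) (s t : seq 'I_15) :
    lead_coef (weight_map K w f) = \prod_(n <- s) 'X_n ->
    lead_coef (weight_map K w g) = \prod_(n <- t) 'X_n ->
  ~~ has (mem s) t -> cop f g.
Proof.
move=> ef eg st; apply: cop_weight (initial_neq0 ef) ef eg _.
exact: cop_vars.
Qed.

Lemma column_dt_neq0 a b c : uniq [:: a; b; c] ->
  dt (column a) (column b) (column c) != 0.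
Proof.
rewrite /= !inE !negb_or !andbT => /andP[/andP[]].
move=> /eq_false2 ab /eq_false2 ac /eq_false2 bc.
apply/initial_neq0/(@initial_column_dt [:: idx r0 a; idx r1 b; idx r2 c]).
by rewrite /indicator_weight !inE !idx_eq /= !eqxx !(ab, ac, bc).
Qed.

Lemma cop_dt_shared2 a b c d : uniq [:: a; b; c; d] ->
  cop (dt (column a) (column b) (column c))
      (dt (column a) (column b) (column d)).
Proof.
rewrite /= !inE !negb_or !andbT => /and3P[/and3P[]].
move=> /eq_false2 ab /eq_false2 ac /eq_false2 ad /andP[].
move=> /eq_false2 bc /eq_false2 bd /eq_false2 cd.
have -> : dt (column a) (column b) (column d)
     = dt (column d) (column a) (column b).
  by rewrite /dt /dot /cross !vec3E /minor; ring.
(* W is the support of x_a y_b z_c and x_d y_a z_b, which are the only terms of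
   the respective minors supported in W. *)
pose W := [:: idx r0 a; idx r1 b; idx r2 c; idx r0 d; idx r1 a; idx r2 b].
apply: (@cop_initial_vars (indicator_weight W)).
- apply: initial_column_dt.
  by rewrite /indicator_weight !inE !idx_eq /= !eqxx !(ab, ac, ad, bc, bd, cd).
- apply: initial_column_dt.
  by rewrite /indicator_weight !inE !idx_eq /= !eqxx !(ab, ac, ad, bc, bd, cd).
by rewrite /= !inE !idx_eq /= !(ab, ac, ad, bc, bd, cd).
Qed.

Lemma cop_dt_shared1 a b c d e : uniq [:: a; b; c; d; e] ->
  cop (dt (column a) (column b) (column c))
      (dt (column a) (column d) (column e)).
Proof.
rewrite /= !inE !negb_or !andbT => /and4P[/and4P[]].
move=> /eq_false2 ab /eq_false2 ac /eq_false2 ad /eq_false2 ae /and3P[].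
move=> /eq_false2 bc /eq_false2 bd /eq_false2 be /andP[].
move=> /eq_false2 cd /eq_false2 ce /eq_false2 de.
have -> : dt (column a) (column d) (column e)
     = - dt (column d) (column a) (column e).
  by rewrite /dt /dot /cross !vec3E /minor; ring.
apply: copNr.
(* The leading terms are x_a y_b z_c and x_d y_a z_e; the swap of columns makes a contribute y_a to
   the second, so they share no variable. *)
pose W := [:: idx r0 a; idx r1 b; idx r2 c; idx r0 d; idx r1 a; idx r2 e].
apply: (@cop_initial_vars (indicator_weight W)).
- apply: initial_column_dt.
  by rewrite /indicator_weight !inE !idx_eq /= !eqxx
    !(ab, ac, ad, ae, bc, bd, be, cd, ce, de).
- apply: initial_column_dt.
  by rewrite /indicator_weight !inE !idx_eq /= !eqxx
    !(ab, ac, ad, ae, bc, bd, be, cd, ce, de).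
by rewrite /= !inE !idx_eq /= !(ab, ac, ad, ae, bc, bd, be, cd, ce, de).
Qed.

Lemma cop_column_minors a b : a != b ->
  cop (minor (column a) (column b) r0 r1) (minor (column a) (column b) r0 r2).
Proof.
move=> /eq_false2 ab.
have -> : minor (column a) (column b) r0 r2
     = - minor (column b) (column a) r0 r2.
  by rewrite /minor opprB mulrC [X in _ - X]mulrC.
(* The leading terms are x_a y_b and x_b z_a. *)
apply: copNr; pose W := [:: idx r0 a; idx r1 b; idx r0 b; idx r2 a].
apply: (@cop_initial_vars (indicator_weight W) _ _ [:: idx r0 a; idx r1 b]
   [:: idx r0 b; idx r2 a]).
- rewrite !big_cons big_nil mulr1.
  apply: initial_minor; try exact: column_graded.
    by rewrite mulf_neq0 // mpolyX_neq0.
  by rewrite /indicator_weight !inE !idx_eq /= !eqxx !ab.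
- rewrite !big_cons big_nil mulr1.
  apply: initial_minor; try exact: column_graded.
    by rewrite mulf_neq0 // mpolyX_neq0.
  by rewrite /indicator_weight !inE !idx_eq /= !eqxx !ab.
by rewrite /= !inE !idx_eq /= !ab.
Qed.

Lemma column_minor_neq0 a b : a != b ->
  minor (column a) (column b) r0 r1 != 0.
Proof.
move=> /eq_false2 ab; pose W := [:: idx r0 a; idx r1 b].
apply: (@initial_neq0 (indicator_weight W) _ W).
rewrite !big_cons big_nil mulr1; apply: initial_minor; try exact: column_graded.
  by rewrite mulf_neq0 // mpolyX_neq0.
by rewrite /indicator_weight !inE !idx_eq /= !eqxx !ab.
Qed.

End Columns.

(** * The resolution *)

Section Homogeneous.
Variables (K : fieldType) (n : nat).
Local Notation S := {mpoly K[n]}.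

Lemma homog_degP (d : nat) (p : S) :
  reflect (homog_deg d%:Z p) (p \is d.-homog).
Proof.
apply: (iffP (dhomogP _ d p)) => h m /h; first by move=> /= ->.
by case.
Qed.

Lemma homog_deg_mcoeff0 (d : nat) (p : S) : homog_deg d.+1%:Z p -> p@_0%MM = 0.
Proof.
move=> h; apply/eqP; apply: contraT; rewrite -mcoeff_msupp => /h.
by rewrite mdeg0.
Qed.

Lemma dhomog_mderiv d (p : S) i : p \is d.+1.-homog -> p^`M(i) \is d.-homog.
Proof.
move/dhomogP=> h; apply/dhomogP => m; rewrite mcoeff_msupp mcoeff_mderiv.
move=> nz; have /h : (m + U_(i))%MM \in msupp p.
  by rewrite mcoeff_msupp; apply: contraNneq nz => ->; rewrite mul0rn.
by rewrite /= mdegD mdeg1 addn1 => -[].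
Qed.

(** As row vectors, the fields killing a polynomial are the syzygies of its partial derivatives. *)
Definition vfield (u : 'rV[S]_n) (p : S) : S := \sum_i u 0 i * p^`M(i).

Lemma vfieldD u : {morph vfield u : p q / p + q}.
Proof.
move=> p q; rewrite /vfield -big_split /=; apply: eq_bigr => i _.
by rewrite mderivD mulrDr.
Qed.

Lemma vfieldM u p q : vfield u (p * q) = vfield u p * q + p * vfield u q.
Proof.
rewrite /vfield mulr_suml mulr_sumr -big_split /=; apply: eq_bigr => i _.
by rewrite mderivM; ring.
Qed.

Lemma vfieldZ u c p : vfield u (c *: p) = c *: vfield u p.
Proof.
rewrite /vfield scaler_sumr; apply: eq_bigr => i _.
by rewrite mderivZ scalerAr.
Qed.

Lemma vfieldX u i : vfield u 'X_i = u 0 i.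
Proof.
rewrite /vfield (bigD1 i) //= big1 => [|j ji]; rewrite mderivX mnm1E.
  rewrite eqxx scale1r (_ : (U_(i) - U_(i) = 0)%MM) ?mpolyX0 ?mulr1 ?addr0 //.
  by apply/mnmP => k; rewrite mnmBE subnn mnm0E.
by rewrite eq_sym (negPf ji) scale0r mulr0.
Qed.

End Homogeneous.

(** * The free resolution and its regularity *)

Section Resolution.
Variables (K : fieldType) (c1 c2 c3 c4 c5 : 'I_5).
Local Notation S := {mpoly K[15]}.
Local Notation col := (column K).

Hypothesis c_uniq : uniq [:: c1; c2; c3; c4; c5].
Hypothesis two_neq0 : 2%:R != 0 :> K.
Hypothesis three_neq0 : 3%:R != 0 :> K.

Local Notation f123 := (dt (col c1) (col c2) (col c3)).
Local Notation f124 := (dt (col c1) (col c2) (col c4)).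
Local Notation f134 := (dt (col c1) (col c3) (col c4)).
Local Notation f234 := (dt (col c2) (col c3) (col c4)).
Local Notation f125 := (dt (col c1) (col c2) (col c5)).
Local Notation f135 := (dt (col c1) (col c3) (col c5)).

Definition Qcols : S := sixfold (col c1) (col c2) (col c3) (col c4) (col c5).

Let c_neq :
  ((c1 == c2) = false) * ((c1 == c3) = false) * ((c1 == c4) = false) *
  ((c1 == c5) = false) * ((c2 == c3) = false) * ((c2 == c4) = false) *
  ((c2 == c5) = false) * ((c3 == c4) = false) * ((c3 == c5) = false) *
  ((c4 == c5) = false).
Proof.
move: c_uniq; rewrite /= !inE !negb_or !andbT => /and4P[/and4P[]].
move=> /negPf-> /negPf-> /negPf-> /negPf-> /and3P[/negPf-> /negPf-> /negPf->].
by move=> /andP[/negPf-> /negPf->] /negPf->.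
Qed.

Let c_neqC :
  ((c2 == c1) = false) * ((c3 == c1) = false) * ((c4 == c1) = false) *
  ((c5 == c1) = false) * ((c3 == c2) = false) * ((c4 == c2) = false) *
  ((c5 == c2) = false) * ((c4 == c3) = false) * ((c5 == c3) = false) *
  ((c5 == c4) = false).
Proof. by do !split; rewrite eq_sym c_neq. Qed.

(** Allows the coprimality of determinants to be used with the columns listed in any order. *)
Lemma cop_pm (f g f' g' : S) :
  f' = f \/ f' = - f -> g' = g \/ g' = - g -> cop f g -> cop f' g'.
Proof.
case=> ->; case=> -> // cfg; try exact: copNr; try exact: copNl.
exact/copNl/copNr.
Qed.

Local Ltac vring := rewrite /dt /dot /cross !vec3E /minor; ring.

Local Ltac by_cop c := apply: (cop_pm _ _ c);
  [by [left; vring | right; vring] | by [left; vring | right; vring]].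

Local Ltac cuniq := by rewrite /= !inE !c_neq ?c_neqC.

Local Ltac shared2 a b c d :=
  by_cop (@cop_dt_shared2 K a b c d ltac:(cuniq)).
Local Ltac shared1 a b c d e :=
  by_cop (@cop_dt_shared1 K a b c d e ltac:(cuniq)).

Lemma dt_cols_neq0 : [/\ f123 != 0, f124 != 0, f134 != 0, f234 != 0 &
  f125 != 0 /\ f135 != 0].
Proof. by do !split; apply: column_dt_neq0; cuniq. Qed.

(** The factors are split off one by one, each being coprime to the product of the remaining
    ones. *)
Lemma Qcols_factors u : (exists c, vfield u Qcols = c * Qcols) ->
  [/\ exists c, vfield u f123 = c * f123, exists c, vfield u f124 = c * f124,
      exists c, vfield u f134 = c * f134, exists c, vfield u f234 = c * f234 &
      (exists c, vfield u f125 = c * f125) /\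
      (exists c, vfield u f135 = c * f135)].
Proof.
have [n123 n124 n134 n234 [n125 n135]] := dt_cols_neq0.
have factor := D_log_factors (vfieldM u).
case/(factor _ _ n123) => [|h123].
  do !apply: copMr; [shared2 c1 c2 c3 c4 | shared2 c1 c3 c2 c4
    | shared2 c2 c3 c1 c4 | shared2 c1 c2 c3 c5 | shared2 c1 c3 c2 c5].
case/(factor _ _ n124) => [|h124].
  do !apply: copMr; [shared2 c1 c4 c2 c3 | shared2 c2 c4 c1 c3
    | shared2 c1 c2 c4 c5 | shared1 c1 c2 c4 c3 c5].
case/(factor _ _ n134) => [|h134].
  do !apply: copMr; [shared2 c3 c4 c1 c2 | shared1 c1 c3 c4 c2 c5
    | shared2 c1 c3 c4 c5].
case/(factor _ _ n234) => [|h234].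
  by do !apply: copMr; [shared1 c2 c3 c4 c1 c5 | shared1 c3 c2 c4 c1 c5].
by case/(factor _ _ n125) => [|h125 h135]; first shared2 c1 c5 c2 c3.
Qed.

Let cols_cover j : j \in [:: c1; c2; c3; c4; c5].
Proof.
apply: contraT => jc; have := max_card (mem [:: j; c1; c2; c3; c4; c5]).
by rewrite (card_uniqP _) ?card_ord // cons_uniq jc.
Qed.

(** Coordinates 0 to 8 list the matrix row by row; the last one, 13, is the parameter m of the
    exceptional field. *)
Definition param (w : 'rV[S]_14) : field_param S :=
  FieldParam (fun i j => w 0 (inord (3 * i + j))) (w 0 (inord 9))
    (w 0 (inord 10)) (w 0 (inord 11)) (w 0 (inord 12)) (w 0 (inord 13)).

(* The weight of column 5, forced by the vanishing of the logarithmic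
   derivative computed in [D_sixfold]. *)
Definition weight5 (p : field_param S) : S :=
  (fpm p * f123 - (6 * tr3 (fpB p) + 5 * fp1 p + 4 * fp2 p + 4 * fp3 p))
  * (2^-1)%:MP.

Definition field_entry (p : field_param S) (i : 'I_3) (j : 'I_5) : S :=
  dot (fpB p i) (col j) +
  (if j == c1 then fp1 p * col c1 i
   else if j == c2 then fp2 p * col c2 i
   else if j == c3 then fp3 p * col c3 i
   else if j == c4 then 0
   else fpn p * col c1 i + fpm p * f135 * col c2 i + weight5 p * col c5 i).

Definition field_row (w : 'rV[S]_14) : 'rV[S]_15 :=
  \row_n field_entry (param w) (inord (n %/ 5)) (inord (n %% 5)).

Lemma field_row_idx w i j : field_row w 0 (idx i j) = field_entry (param w) i j.
Proof.
rewrite mxE; have := (ltn_ord i, ltn_ord j) => -[hi hj].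
have hij : (5 * i + j < 15)%N by lia.
have /= ei : inord (idx i j %/ 5) = i.
  by apply: val_inj; rewrite /= !inordK //; lia.
have /= ej : inord (idx i j %% 5) = j.
  by apply: val_inj; rewrite /= !inordK //; lia.
by rewrite ei ej.
Qed.

Lemma idx_surj n : exists i j, n = idx i j.
Proof.
exists (inord (n %/ 5)), (inord (n %% 5)); have := ltn_ord n => hn.
by apply: val_inj; rewrite /= !inordK //; lia.
Qed.

Lemma rV15P (u u' : 'rV[S]_15) :
  (forall i j, u 0 (idx i j) = u' 0 (idx i j)) -> u = u'.
Proof. by move=> h; apply/rowP => n; have [i [j ->]] := idx_surj n. Qed.

Definition param_comb (a : S) (p p' : field_param S) : field_param S :=
  FieldParam (fun i j => a * fpB p i j + fpB p' i j) (a * fp1 p + fp1 p')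
    (a * fp2 p + fp2 p') (a * fp3 p + fp3 p') (a * fpn p + fpn p')
    (a * fpm p + fpm p').

Lemma field_entry_comb a p p' i j :
  field_entry (param_comb a p p') i j
  = a * field_entry p i j + field_entry p' i j.
Proof.
rewrite /field_entry /weight5 /tr3 /dot /=.
case: p p' => B ? ? ? ? ? [B' ? ? ? ? ?] /=.
move: (B r0 r0) (B r1 r1) (B r2 r2) (B' r0 r0) (B' r1 r1) (B' r2 r2).
move: (B i r0) (B i r1) (B i r2) (B' i r0) (B' i r1) (B' i r2).
move: (2^-1)%:MP f123 f135 (col j r0) (col j r1) (col j r2).
move: (col c1 i) (col c2 i) (col c3 i) (col c5 i) => *.
by do !case: ifP => _; ring.
Qed.

Fact field_row_linear : linear field_row.
Proof.
move=> a w w'; apply: rV15P => i j.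
rewrite [RHS]mxE [in RHS]mxE !field_row_idx -field_entry_comb.
congr field_entry; rewrite /param /param_comb /=.
by congr FieldParam; [apply/funext => k; apply/funext => l| | | | |];
  rewrite !mxE.
Qed.

HB.instance Definition _ :=
  GRing.isLinear.Build S 'rV[S]_14 'rV[S]_15 _ field_row field_row_linear.

Lemma field_row_is_field w u : u = field_row w ->
  is_field (col c1) (col c2) (col c3) (col c4) (col c5)
    (param w) (weight5 (param w))
    (vfield u \o col c1) (vfield u \o col c2) (vfield u \o col c3)
    (vfield u \o col c4) (vfield u \o col c5).
Proof.
move=> ->; split=> i; rewrite /= vfieldX field_row_idx /field_entry.
- by rewrite eqxx.
- by rewrite eqxx !c_neqC.
- by rewrite eqxx !c_neqC.
- by rewrite eqxx !c_neqC addr0.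
- by rewrite !c_neqC -!addrA.
Qed.

Lemma param_surj (p : field_param S) : exists w, param w = p.
Proof.
exists (\row_n [:: fpB p r0 r0; fpB p r0 r1; fpB p r0 r2; fpB p r1 r0;
  fpB p r1 r1; fpB p r1 r2; fpB p r2 r0; fpB p r2 r1; fpB p r2 r2; fp1 p; fp2 p;
  fp3 p; fpn p; fpm p]`_n).
case: p => B ? ? ? ? ?; congr FieldParam; rewrite ?mxE ?inordK //=.
apply/funext; apply: forall3; apply/funext; apply: forall3;
  by rewrite mxE inordK.
Qed.

Lemma two_weight5 p : 2 * weight5 p =
  fpm p * f123 - (6 * tr3 (fpB p) + 5 * fp1 p + 4 * fp2 p + 4 * fp3 p).
Proof.
rewrite /weight5 mulrCA -[RHS]mulr1; congr (_ * _).
by rewrite -mpolyCMn -mpolyCM divff.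
Qed.

(** Exactness at the middle term. A field killing [Qcols] preserves each factor, hence comes from
    parameters; conversely [weight5] cancels the logarithmic derivative. *)
Lemma vfield_Qcols_eq0 u : vfield u Qcols = 0 <-> exists w, u = field_row w.
Proof.
have [n123 n124 n134 n234 [n125 n135]] := dt_cols_neq0.
split=> [u0|[w uw]]; last first.
  rewrite (D_sixfold (vfieldD u) (vfieldM u) (field_row_is_field uw)).
  by rewrite two_weight5; ring.
have [|h123 h124 h134 h234 [h125 h135]] := @Qcols_factors u.
  by exists 0; rewrite mul0r.
have unit3 : (3 : S) \is a GRing.unit.
  rewrite -mpolyC_nat; apply/unitrP; exists (3^-1)%:MP.
  by rewrite -!mpolyCM mulVf ?mulfV.
have [p [l5 hp]] : exists p l5,
    is_field (col c1) (col c2) (col c3) (col c4) (col c5) p l5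
    (vfield u \o col c1) (vfield u \o col c2) (vfield u \o col c3)
    (vfield u \o col c4) (vfield u \o col c5).
  apply: (logarithmic_field n123 (vfieldD u) (vfieldM u)) => //.
  - by shared2 c1 c2 c3 c4.
  - by shared2 c1 c3 c5 c2.
  - by apply: column_minor_neq0; rewrite c_neq.
  - by apply: cop_column_minors; rewrite c_neq.
(* [Qcols] is not 0, so the cofactor in [D_sixfold] vanishes; then 2 is cancelled. *)
have e5 : l5 = weight5 p.
  have := D_sixfold (vfieldD u) (vfieldM u) hp; rewrite u0 => /esym/eqP.
  rewrite mulf_eq0 => /orP[/eqP e|]; last by rewrite !mulf_eq0 (negPf n123)
    (negPf n124) (negPf n134) (negPf n234) (negPf n125) (negPf n135).
  have n2 : 2 != 0 :> S by rewrite -mpolyC_nat mpolyC_eq0.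
  apply: (mulfI n2); rewrite two_weight5; apply: subr0_eq.
  by rewrite -[RHS]e; ring.
have [w ew] := param_surj p; rewrite e5 -{}ew in hp.
exists w; apply: rV15P => i j; rewrite -vfieldX field_row_idx.
have [h1 h2 h3 h4 h5] := hp; rewrite /field_entry.
have := cols_cover j; rewrite !inE => /or4P[/eqP->|/eqP->|/eqP->|].
- by rewrite eqxx -h1.
- by rewrite eqxx !c_neqC -h2.
- by rewrite eqxx !c_neqC -h3.
case/orP=> /eqP->.
- by rewrite eqxx !c_neqC addr0 -h4.
- by rewrite !c_neqC !addrA -h5.
Qed.

(** Exactness at the last term of the resolution. *)
Lemma field_row_inj w : field_row w = 0 -> w = 0.
Proof.
have [n123 n124 n134 n234 [n125 n135]] := dt_cols_neq0.
move=> w0; have hp := field_row_is_field (esym w0).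
have [|B0 [p1 p2 p3 pn pm]] := field_eq0 n123 n124 n134 n234 n125 n135 hp.
  by move=> i; rewrite /= !vfieldX !mxE.
apply/rowP => n; rewrite [RHS]mxE.
have [lt9|ge9] := ltnP n 9.
  rewrite -(B0 (inord (n %/ 3)) (inord (n %% 3))) /=; congr (w 0 _).
  have q3 : (n %/ 3 < 3)%N by rewrite ltn_divLR.
  rewrite inordK // inordK ?ltn_mod // [(3 * _)%N]mulnC -divn_eq.
  by rewrite inord_val.
have : (n : nat) \in [:: 9; 10; 11; 12; 13]%N.
  by have := ltn_ord n; rewrite !inE; lia.
have wE k : n = k :> nat -> w 0 n = w 0 (inord k).
  by move=> <-; rewrite inord_val.
by rewrite !inE => /or4P[/eqP/wE->|/eqP/wE->|/eqP/wE->|/orP[]/eqP/wE->].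
Qed.

Lemma column_dhomog j i : (col j i : S) \is 1.-homog.
Proof. by rewrite dhomogX /= mdeg1. Qed.

Lemma dot_dhomog (x y : 'I_3 -> S) d e :
  (forall i, x i \is d.-homog) -> (forall i, y i \is e.-homog) ->
  dot x y \is (d + e).-homog.
Proof. by move=> hx hy; rewrite /dot !rpredD // dhomogM. Qed.

Lemma dt_dhomog a b c : dt (col a) (col b) (col c) \is 3.-homog.
Proof.
apply: (@dot_dhomog _ _ 1 2) => [i|]; first exact: column_dhomog.
by apply: forall3; rewrite /cross vec3E /minor rpredB //;
  apply: (@dhomogM _ _ _ 1 _ 1); apply: column_dhomog.
Qed.

Lemma Qcols_dhomog : Qcols \is 18.-homog.
Proof.
do 4![apply: (@dhomogM _ _ _ 3); first exact: dt_dhomog].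
by apply: (@dhomogM _ _ _ 3 _ 3); exact: dt_dhomog.
Qed.

(** [fpm p] has degree d - 3, so it must be 0 when d = 0; testing it against cubics covers d = 0 and
    d = 3 alike. *)
Lemma field_entry_dhomog (p : field_param S) d :
    (forall i j, fpB p i j \is d.-homog) -> fp1 p \is d.-homog ->
    fp2 p \is d.-homog -> fp3 p \is d.-homog -> fpn p \is d.-homog ->
    (forall g : S, g \is 3.-homog -> fpm p * g \is d.-homog) ->
  forall i j, field_entry p i j \is d.+1.-homog.
Proof.
move=> hB h1 h2 h3 hn hm i j; rewrite -[d.+1]addn1 /field_entry.
have hmul (a b : S) :
    a \is d.-homog -> b \is 1.-homog -> a * b \is (d + 1).-homog.
  exact: dhomogM.
have hnat (k : nat) (a : S) : a \is d.-homog -> k%:R * a \is d.-homog.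
  by move=> ha; rewrite mulr_natl rpredMn.
have h5 : weight5 p \is d.-homog.
  rewrite /weight5 mulrC mul_mpolyC rpredZ // rpredB //.
    exact/hm/dt_dhomog.
  by rewrite !rpredD // hnat // /tr3 !rpredD.
rewrite rpredD //; first exact: dot_dhomog (hB i) (column_dhomog j).
do !case: ifP => _; rewrite ?rpred0 ?rpredD //; apply: hmul => //;
  try exact: column_dhomog.
exact/hm/dt_dhomog.
Qed.

Definition res_rk (p : nat) : nat :=
  match p with 0 => 1 | 1 => 15 | 2 => 14 | _ => 0 end.

(** 17 is the degree of the partial derivatives; 18 = 17 + 1 and 21 = 17 + 4 add the degrees of the
    vector fields. Beyond p = 2 the index type is empty. *)
Definition res_sh (p : nat) : 'I_(res_rk p) -> int :=
  match p with
  | 0 => fun=> 0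
  | 1 => fun=> 17
  | _ => fun j => if val j == 13%N then 21 else 18
  end.

Variable Q : S.

Definition res_d (p : nat) : 'M[S]_(res_rk p.+1, res_rk p) :=
  match p with
  | 0 => \col_i Q^`M(i)
  | 1 => lin1_mx field_row
  | _ => 0
  end.

Definition milnor_resolution : resolution_data (milnor_algebra Q) :=
  @ResolutionData K 15 (milnor_algebra Q) res_rk res_sh res_d
    (fun=> to_quot (fun i : 'I_15 => Q^`M(i)) 1).

Lemma field_row_delta_dhomog (i : 'I_14) n :
  field_row (delta_mx 0 i) 0 n \is (if i == 13 :> nat then 4 else 1).-homog.
Proof.
have [k [j ->]] := idx_surj n; rewrite field_row_idx.
have h1 m : (delta_mx 0 i : 'rV[S]_14) 0 m \is 0.-homog.
  by rewrite mxE eqxx; case: (m == i); rewrite ?dhomog1 ?rpred0.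
have h0 m : m != i -> (delta_mx 0 i : 'rV[S]_14) 0 m = 0.
  by move=> mi; rewrite mxE eqxx (negPf mi).
case: ifP => i13.
  have h m : (m < 13)%N -> (delta_mx 0 i : 'rV[S]_14) 0 (inord m) = 0.
    move=> m13; apply: h0; rewrite -val_eqE /= inordK ?(eqP i13); last by lia.
    by rewrite neq_ltn m13.
  apply: (@field_entry_dhomog _ 3) => /=; try by rewrite h // rpred0.
    move=> a b; rewrite h ?rpred0 //.
    by have ha := ltn_ord a; have hb := ltn_ord b; lia.
  by move=> g hg; apply: (@dhomogM _ _ _ 0).
apply: (@field_entry_dhomog _ 0) => //= g _; rewrite h0 ?mul0r ?rpred0 //.
by rewrite -val_eqE /= inordK // eq_sym i13.
Qed.

Hypothesis Q_sign : Q = Qcols \/ Q = - Qcols.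

Lemma milnor_resolution_minimal :
  minimal_graded_free_resolution (@milnor_grading K 15 Q) milnor_resolution.
Proof.
have Qh : Q \is 18.-homog.
  by case: Q_sign => ->; rewrite ?rpredN Qcols_dhomog.
have vQ u : vfield u Q = 0 <-> vfield u Qcols = 0.
  case: Q_sign => -> //; rewrite -scaleN1r vfieldZ scaleN1r.
  by split=> /eqP; [rewrite oppr_eq0 => /eqP | move/eqP ->; rewrite oppr0].
have dh0 i j : res_d 0 i j \is 17.-homog by rewrite mxE dhomog_mderiv.
have dh1 (i : 'I_14) (j : 'I_15) :
    (lin1_mx field_row : 'M_(14, 15)) i j
      \is (if i == 13 :> nat then 4 else 1).-homog.
  by rewrite mxE field_row_delta_dhomog.
pose tq : S -> milnor_algebra Q := to_quot (fun i : 'I_15 => Q^`M(i)).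
have scaleE a y : a *: tq y = tq (a * y) := quot_scaleE _ a y.
have augE v : res_aug_map (F := milnor_resolution) v = tq (v 0 0).
  by rewrite /res_aug_map big_ord1 scaleE mulr1.
have tq0 : tq 0 = 0 by apply: (addrI (tq 0)); rewrite -[LHS]to_quotD !addr0.
split.
- move=> j; exists 1 => //; exact/homog_degP/dhomog1.
- case=> [|[|p]] i j.
  + exact/homog_degP/dh0.
  + by have := dh1 i j; rewrite /=; case: ifP => _ /homog_degP.
  + by case: i.
- move=> x; have [y ->] := to_quot_surj x; exists (const_mx y).
  by rewrite augE mxE.
- move=> v; rewrite augE -tq0 to_quotP subr0; split.
    case/asboolP => c ec; exists (\row_i c i); apply/rowP => j.
    by rewrite (ord1 j) ec mxE; apply: eq_bigr => i _; rewrite !mxE.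
  case=> w ->; apply/asboolP; exists (w 0); rewrite mxE.
  by apply: eq_bigr => i _; rewrite mxE.
- case=> [|[|p]] /= v.
  + rewrite (_ : v *m _ = const_mx (vfield v Q)); last first.
      apply/rowP => j; rewrite !mxE; apply: eq_bigr => i _.
      by rewrite mxE.
    split=> [/rowP/(_ 0)|[w ->]].
      rewrite !mxE => /vQ/vfield_Qcols_eq0[w ->]; exists w.
      by rewrite mul_rV_lin1.
    apply/rowP => j; rewrite !mxE; apply/vQ/vfield_Qcols_eq0; exists w.
    by rewrite mul_rV_lin1.
  + rewrite mul_rV_lin1; split=> [/field_row_inj->|[w ->]].
      by exists 0; rewrite mulmx0.
    by rewrite mulmx0 linear0.
  + split=> _; first by exists 0; apply/rowP; case.
    by apply/rowP => j; rewrite (thinmx0 v) mul0mx.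
(* Minimality: the entries are homogeneous of degree 17, 4 or 1, all positive. *)
- case=> [|[|p]] i j.
  + apply: (@homog_deg_mcoeff0 _ _ 16); apply/homog_degP/dh0.
  + have := dh1 i j; case: ifP => _ /homog_degP; exact: homog_deg_mcoeff0.
  + by case: i.
Qed.

Lemma milnor_regularity : has_regularity (@milnor_grading K 15 Q) 19.
Proof.
exists milnor_resolution; split; first exact: milnor_resolution_minimal.
  (* The last basis element, of index 13, attains 21 - 2; the other values are 0, 17 - 1 and 18 -
     2. *)
  exists 2%N, 21; split=> //; apply/eqP; rewrite -lt0n.
  by apply/card_gt0P; exists (ord_max : 'I_14); rewrite inE.
move=> p q /eqP; rewrite -lt0n => /card_gt0P[j]; rewrite inE => /eqP <-.
case: p j => [|[|[|p]]] //= j; last by case: j.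
by case: ifP.
Qed.

End Resolution.

(** * Minors of the generic matrix and relabelling of its columns *)

Lemma det3 (A : idomainType) (M : 'M[A]_3) (j0 j1 j2 : 'I_3) :
  j0 = 0%N :> nat -> j1 = 1%N :> nat -> j2 = 2%N :> nat ->
  \det M = dt (M^~ j0) (M^~ j1) (M^~ j2).
Proof.
move=> e0 e1 e2.
have E i i' j j' : val i = val i' -> val j = val j' -> M i j = M i' j'.
  by move=> /val_inj -> /val_inj ->.
rewrite (expand_det_col _ ord0) !big_ord_recl big_ord0 /cofactor.
rewrite !(expand_det_col _ ord0) !big_ord_recl !big_ord0 /cofactor.
rewrite !det_mx11 !mxE /=.
rewrite /dt /dot /cross !vec3E /minor.
pose m k l := M (nth r0 [:: r0; r1; r2] k) (nth r0 [:: j0; j1; j2] l).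
have mE i j : M i j = m (val i) (val j).
  rewrite /m; apply: E; case: i j => [[|[|[|i]]] hi] [[|[|[|j]]] hj] //=;
    by rewrite ?e0 ?e1 ?e2.
by rewrite !mE /= e0 e1 e2 /=; ring.
Qed.

Section Permuted.
Variable A : idomainType.
Variables v1 v2 v3 v4 v5 : 'I_3 -> A.

Lemma dt_swap12 x y z : dt y x z = - dt x y z :> A.
Proof. by rewrite /dt /dot /cross !vec3E /minor; ring. Qed.

Lemma dt_swap23 x y z : dt x z y = - dt x y z :> A.
Proof. by rewrite /dt /dot /cross !vec3E /minor; ring. Qed.

Lemma sixfoldE : sixfold v1 v2 v3 v4 v5 =
  dt v1 v2 v3 * dt v1 v2 v4 * dt v1 v3 v4 * dt v2 v3 v4 * dt v1 v2 v5
  * dt v1 v3 v5.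
Proof. by rewrite /sixfold !mulrA. Qed.

(** The swap permutes the first five factors with three signs and changes the sixth. The swap of v3
    and v4 does the same with two signs, so together they reach all four products. *)
Lemma sixfold_swap12 : sixfold v2 v1 v3 v4 v5 =
  - (dt v1 v2 v3 * dt v1 v2 v4 * dt v1 v3 v4 * dt v2 v3 v4 * dt v1 v2 v5
     * dt v2 v3 v5).
Proof.
rewrite /sixfold !(dt_swap12 v1 v2).
move: (dt v1 v2 v3) (dt v1 v2 v4) (dt v1 v3 v4) (dt v2 v3 v4) (dt v1 v2 v5).
by move=> a b c d e; move: (dt _ _ _) => f; ring.
Qed.

Lemma sixfold_swap34 : sixfold v1 v2 v4 v3 v5 =
  dt v1 v2 v3 * dt v1 v2 v4 * dt v1 v3 v4 * dt v2 v3 v4 * dt v1 v2 v5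
  * dt v1 v4 v5.
Proof.
rewrite /sixfold !(dt_swap23 _ v3 v4).
move: (dt v1 v2 v3) (dt v1 v2 v4) (dt v1 v3 v4) (dt v2 v3 v4) (dt v1 v2 v5).
by move=> a b c d e; move: (dt _ _ _) => f; ring.
Qed.

Lemma sixfold_swap12_34 : sixfold v2 v1 v4 v3 v5 =
  - (dt v1 v2 v3 * dt v1 v2 v4 * dt v1 v3 v4 * dt v2 v3 v4 * dt v1 v2 v5
     * dt v2 v4 v5).
Proof.
rewrite /sixfold !(dt_swap23 _ v3 v4) !(dt_swap12 v1 v2).
move: (dt v1 v2 v3) (dt v1 v2 v4) (dt v1 v3 v4) (dt v2 v3 v4) (dt v1 v2 v5).
by move=> a b c d e; move: (dt _ _ _) => f; ring.
Qed.

End Permuted.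

Lemma Delta_columns (R : realType) (a b c : nat) :
  Delta R a b c = dt (column R[i] (inord a.-1)) (column R[i] (inord b.-1))
                     (column R[i] (inord c.-1)).
Proof.
rewrite /Delta (@det3 _ _ r0 r1 r2) //.
by congr dt; apply/funext => i; rewrite !mxE.
Qed.

Theorem corollary1p9 (R : realType) (k : nat) (hk : k \in [:: 6; 7; 8; 9]%N) :
  has_regularity (@milnor_grading R[i] 15 (Qpoly R k)) 19.
Proof.
pose c j : 'I_5 := inord j.
have cE i j : (i < 5)%N -> (j < 5)%N -> (c i == c j) = (i == j).
  by move=> hi hj; rewrite -val_eqE /= !inordK.
have nz m : m.+1%:R != 0 :> R[i] by rewrite pnatr_eq0.
(* Columns count from 0 here, and [nz m] concerns m + 1, so [nz 1] and [nz 2] say that 2 and 3 are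
   nonzero. *)
have reg c1 c2 c3 c4 u :=
  @milnor_regularity R[i] (c c1) (c c2) (c c3) (c c4) (c 4%N)
    u (nz 1%N) (nz 2%N).
move: hk; rewrite !inE => /or4P[] /eqP->;
  rewrite /Qpoly /fDelta /= !Delta_columns.
(* The sixth factor is the minor 135, 235, 145 or 245: no swap, the swap of columns 1 and 2, that of
   columns 3 and 4, or both. *)
- apply: (reg 0 1 2 3)%N; [by rewrite /= !inE !cE | left].
  by rewrite /Qcols sixfoldE; do 5!congr (_ * _).
- apply: (reg 1 0 2 3)%N; [by rewrite /= !inE !cE | right].
  by rewrite /Qcols sixfold_swap12 opprK; do 5!congr (_ * _).
- apply: (reg 0 1 3 2)%N; [by rewrite /= !inE !cE | left].
  by rewrite /Qcols sixfold_swap34; do 5!congr (_ * _).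
- apply: (reg 1 0 3 2)%N; [by rewrite /= !inE !cE | right].
  by rewrite /Qcols sixfold_swap12_34 opprK; do 5!congr (_ * _).
Qed.
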